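(* For every residue function $\tilde r:\mathbb{N}_{>1}\to\mathbb{N}$, the theory $T_{\tilde r}$ is a complete consistent extension of $T_{\mathrm{MSO(Fin)}}$. Moreover, every complete consistent $\mathcal{L}$-theory extending $T_{\mathrm{MSO(Fin)}}$ which is not equal to $\mathrm{Th}(\mathrm{MSO}(n))$ for any $n\in\mathbb{N}$ has the same consequences as $T_{\tilde r}$ for some residue function $\tilde r$.
   Context: $\mathbb{N}=\{0,1,2,\dots\}$, $\mathbb{P}$ is the set of primes. Let $\mathcal{L}=\{\subseteq,\bot,\mathrm{At},\lhd\}$ be the first-order language with binary relation symbols $\subseteq,\lhd$, a constant $\bot$ and a unary relation symbol $\mathrm{At}$. For a linear order $(\alpha,<)$, $\mathrm{MSO}(\alpha)$ is the $\mathcal{L}$-structure with universe $\mathcal{P}(\alpha)$, $\subseteq$ inclusion, $\bot=\emptyset$, $\mathrm{At}$ the singletons, and $A\lhd B$ iff some $a\in A$, $b\in B$ have $a<b$; $\mathrm{MSO}(n)$ is this for the $n$-element order. Lowercase variables range over atoms; $X(x)$ abbreviates $x\subseteq X$. $T_{\mathrm{base}}$ states: $\subseteq$ is an atomic Boolean algebra order (one-element algebra allowed); $\lhd$ linearly orders the atoms; $\bot$ is least; $\mathrm{At}$ holds exactly of atoms; $\forall X\forall Y(X\lhd Y\leftrightarrow\exists x\exists y(X(x)\wedge Y(y)\wedge x\lhd y))$; and for every $\mathcal{L}$-formula $\eta(x;\bar Y)$, $\forall\bar Y\exists X\forall x(X(x)\leftrightarrow\eta(x;\bar Y))$. $T_{\mathrm{MSO(Fin)}}$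 is $T_{\mathrm{base}}$ plus: the order on atoms is discrete with endpoints, and every $X\neq\bot$ contains a $\lhd$-least atom. In models of $T_{\mathrm{MSO(Fin)}}$, $0$ denotes the least atom and $0^*$ the greatest atom. For $d\ge1$ and $1\le h\le d$, $\rho_{d,h}$ is the $\mathcal{L}$-sentence saying: there exist non-bottom elements $A_1,\dots,A_d$ partitioning the set of atoms such that $A_1(0)$; for every atom $a\neq 0^*$ and every $1\le i\le d$, if $A_i(a)$ then $A_{i'}(a')$ where $a'$ is the immediate successor of $a$ and $i'=i+1$ if $i<d$, $i'=1$ if $i=d$; and $A_h(0^* )$. For an arbitrary integer $h$, $\rho_{d,h}$ means $\rho_{d,h'}$ with $h'\in\{1,\dots,d\}$, $h'\equiv h \pmod d$. For $n\in\mathbb{N}$, $\psi_{>n}$ is the sentence saying there are at least $n+1$ distinct atoms, and $T_\infty=\{\psi_{>n}:n\in\mathbb{N}\}$. A function $r:\mathbb{P}\times\mathbb{N}_{>0}\to\mathbb{N}$ is a residue function if $r(p,j)<p^j$ and $r(p,j+1)\equiv r(p,j)\pmod{p^j}$ for all $p,j$; a function $\tilde r:\mathbb{N}_{>1}\to\mathbb{N}$ is called a residue function if there is such an $r$ with $\tilde r(d)<d$ and $\tilde r(d)\equiv r(p,j)\pmod{p^j}$ whenever $p^j\mid d$. For such $\tilde r$, $T_{\tilde r}=T_{\mathrm{MSO(Fin)}}\cup T_\infty\cup\{\rho_{d,\tilde r(d)}:d\in\mathbb{N}_{>1}\}$. *)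

(* Defs.v *)
From mathcomp Require Import all_boot all_order all_algebra.

Set Implicit Arguments.
Unset Strict Implicit.
Unset Printing Implicit Defensive.

Inductive term : Type :=
| Var of nat
| Bot.
Coercion Var : nat >-> term.

Inductive formula : Type :=
| FEq of term & term
| FSub of term & term
| FAt of term
| FLhd of term & term
| FNot of formula
| FAnd of formula & formula
| FEx of nat & formula.

Declare Scope fol_scope.
Delimit Scope fol_scope with F.
Bind Scope fol_scope with formula.

Definition FOr p q := FNot (FAnd (FNot p) (FNot q)).
Definition FImp p q := FNot (FAnd p (FNot q)).
Definition FIff p q := FAnd (FImp p q) (FImp q p).
Definition FAll x p := FNot (FEx x (FNot p)).
Definition FNeq s t := FNot (FEq s t).
Definition FTru := FEq Bot Bot.
Definition FFls := FNot FTru.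
Definition FBigAnd (ps : seq formula) := foldr FAnd FTru ps.
Definition FBigOr (ps : seq formula) := foldr FOr FFls ps.
Definition FAllSeq (xs : seq nat) p := foldr FAll p xs.
Definition FExSeq (xs : seq nat) p := foldr FEx p xs.

(** Lowercase variables range over atoms. *)
Definition FAllAt x p := FAll x (FImp (FAt (Var x)) p).
Definition FExAt x p := FEx x (FAnd (FAt (Var x)) p).

Notation "s '≡' t" := (FEq s t) (at level 70) : fol_scope.
Notation "s '≢' t" := (FNeq s t) (at level 70) : fol_scope.
Notation "s '⊆' t" := (FSub s t) (at level 70) : fol_scope.
Notation "s '◁' t" := (FLhd s t) (at level 70) : fol_scope.
Notation "~ p" := (FNot p) : fol_scope.
Notation "p /\ q" := (FAnd p q) : fol_scope.
Notation "p \/ q" := (FOr p q) : fol_scope.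
Notation "p '⟶' q" := (FImp p q) (at level 90, right associativity) : fol_scope.
Notation "p '⟷' q" := (FIff p q) (at level 95) : fol_scope.

Definition fv_term (t : term) : seq nat := if t is Var x then [:: x] else [::].

Fixpoint fv (p : formula) : seq nat :=
  match p with
  | FEq s t | FSub s t | FLhd s t => fv_term s ++ fv_term t
  | FAt t => fv_term t
  | FNot p => fv p
  | FAnd p q => fv p ++ fv q
  | FEx x p => [seq y <- fv p | y != x]
  end.

Definition sentence (p : formula) : Prop := fv p = [::].

Definition univ_closure (p : formula) := FAllSeq (fv p) p.

Record structure : Type := Structure {
  dom :> Type;
  sub_ : dom -> dom -> Prop;
  bot_ : dom;
  at_ : dom -> Prop;
  lhd_ : dom -> dom -> Prop }.

Definition upd (D : Type) (s : nat -> D) (x : nat) (a : D) : nat -> D :=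
  fun y => if y == x then a else s y.

Definition eval (M : structure) (s : nat -> M) (t : term) : M :=
  if t is Var x then s x else bot_ M.

Fixpoint sat (M : structure) (s : nat -> M) (p : formula) : Prop :=
  match p with
  | FEq t u => eval s t = eval s u
  | FSub t u => sub_ (eval s t) (eval s u)
  | FAt t => at_ (eval s t)
  | FLhd t u => lhd_ (eval s t) (eval s u)
  | FNot p => ~ sat s p
  | FAnd p q => sat s p /\ sat s q
  | FEx x p => exists a : M, sat (upd s x a) p
  end.

Definition holds (M : structure) (p : formula) : Prop :=
  forall s : nat -> M, sat s p.

(** Closedness of the axioms is stated separately, in [is_theory]. *)
Definition theory := formula -> Prop.
Definition is_theory (T : theory) : Prop := forall p, T p -> sentence p.

Definition model (M : structure) (T : theory) : Prop := forall p, T p -> holds M p.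

Definition consequence (T : theory) (p : formula) : Prop :=
  forall M : structure, model M T -> holds M p.

Definition consistent_theory (T : theory) : Prop := exists M : structure, model M T.

Definition complete_theory (T : theory) : Prop :=
  forall p, sentence p -> consequence T p \/ consequence T (FNot p).

Definition extends (T' T : theory) : Prop := forall p, T p -> consequence T' p.

Definition same_consequences (T T' : theory) : Prop :=
  forall p, sentence p -> (consequence T p <-> consequence T' p).

Definition Th (M : structure) : theory := fun p => sentence p /\ holds M p.

Definition MSO_order (disp : Order.disp_t) (A : finOrderType disp) : structure :=
  {| dom := {set A};
     sub_ := fun X Y => X \subset Y;
     bot_ := set0;
     at_ := fun X => exists a, X = [set a];
     lhd_ := fun X Y => exists a b, [/\ a \in X, b \in Y & (a < b)%O] |}.

Definition MSO (n : nat) : structure := MSO_order 'I_n.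

Open Scope fol_scope.

(** In the abbreviations below, [w] is the name of the bound variable; it must
    not occur in the other arguments. *)
Definition is_top w (Z : term) := FAll w (w ⊆ Z).

Definition is_meet w (X Y Z : term) :=
  Z ⊆ X /\ Z ⊆ Y /\ FAll w (w ⊆ X /\ w ⊆ Y ⟶ w ⊆ Z).
Definition is_join w (X Y Z : term) :=
  X ⊆ Z /\ Y ⊆ Z /\ FAll w (X ⊆ w /\ Y ⊆ w ⟶ Z ⊆ w).

Inductive T_base : theory :=
| base_refl : T_base (FAll 0 (0 ⊆ 0))
| base_antisym :
    T_base (FAll 0 (FAll 1 (0 ⊆ 1 /\ 1 ⊆ 0 ⟶ 0 ≡ 1)))
| base_trans :
    T_base (FAll 0 (FAll 1 (FAll 2 (0 ⊆ 1 /\ 1 ⊆ 2 ⟶ 0 ⊆ 2))))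
| base_bot : T_base (FAll 0 (Bot ⊆ 0))
| base_top : T_base (FEx 0 (is_top 1 0))
| base_meet : T_base (FAll 0 (FAll 1 (FEx 2 (is_meet 3 0 1 2))))
| base_join : T_base (FAll 0 (FAll 1 (FEx 2 (is_join 3 0 1 2))))
| base_distr :
    (* with 3 = 1 ∨ 2, 4 = 0 ∧ 3, 5 = 0 ∧ 1 and 6 = 0 ∧ 2, we have 4 = 5 ∨ 6 *)
    T_base (FAllSeq (iota 0 7)
      (is_join 7 1 2 3 /\ is_meet 7 0 3 4 /\ is_meet 7 0 1 5 /\ is_meet 7 0 2 6
       ⟶ is_join 7 5 6 4))
| base_compl :
    T_base (FAll 0 (FEx 1
      (is_meet 2 0 1 Bot /\ FEx 3 (is_top 2 3 /\ is_join 2 0 1 3))))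
| base_at :
    T_base (FAll 0 (FAt 0 ⟷ 0 ≢ Bot /\ FAll 1 (1 ⊆ 0 ⟶ 1 ≡ Bot \/ 1 ≡ 0)))
| base_atomic : T_base (FAll 0 (0 ≢ Bot ⟶ FExAt 1 (1 ⊆ 0)))
| base_lhd_irr : T_base (FAllAt 0 (~ (0 ◁ 0)))
| base_lhd_trans :
    T_base (FAllAt 0 (FAllAt 1 (FAllAt 2 (0 ◁ 1 /\ 1 ◁ 2 ⟶ 0 ◁ 2))))
| base_lhd_total :
    T_base (FAllAt 0 (FAllAt 1 (0 ◁ 1 \/ 0 ≡ 1 \/ 1 ◁ 0)))
| base_lhd :
    T_base (FAll 0 (FAll 1
      (0 ◁ 1 ⟷ FExAt 2 (FExAt 3 (2 ⊆ 0 /\ 3 ⊆ 1 /\ 2 ◁ 3)))))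
| base_comprehension (x X : nat) (eta : formula) :
    x <> X -> X \notin fv eta ->
    T_base (univ_closure (FEx X (FAllAt x (x ⊆ X ⟷ eta)))).

Definition is_least w (x : term) := FAt x /\ FAllAt w (w ≡ x \/ x ◁ w).
Definition is_greatest w (x : term) := FAt x /\ FAllAt w (w ≡ x \/ w ◁ x).

Definition is_succ w (x y : term) := x ◁ y /\ ~ FExAt w (x ◁ w /\ w ◁ y).

Inductive T_MSOFin : theory :=
| fin_base p : T_base p -> T_MSOFin p
  (* the hypothesis keeps MSO(0), which has no atoms, among the models *)
| fin_endpoints :
    T_MSOFin (FEx 0 (FAt 0) ⟶ FEx 0 (is_least 1 0) /\ FEx 0 (is_greatest 1 0))
| fin_succ :
    T_MSOFin (FAllAt 0 (~ is_greatest 1 0 ⟶ FExAt 1 (is_succ 2 0 1)))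
| fin_pred :
    T_MSOFin (FAllAt 0 (~ is_least 1 0 ⟶ FExAt 1 (is_succ 2 1 0)))
| fin_wf :
    T_MSOFin (FAll 0 (0 ≢ Bot ⟶
      FExAt 1 (1 ⊆ 0 /\ FAllAt 2 (2 ⊆ 0 ⟶ 2 ≡ 1 \/ 1 ◁ 2)))).

Definition cnext (d i : nat) : nat := if i < d then i.+1 else 1.

(** The variables 1, ..., d name the sets A_1, ..., A_d; the variables 0, d+1
    and d+2 range over atoms. *)
Definition rho (d h : nat) : formula :=
  let I := iota 1 d in
  FExSeq I
    (FBigAnd [seq Var i ≢ Bot | i <- I]
     /\ FAllAt 0 (FBigOr [seq 0 ⊆ Var i | i <- I])
     /\ FBigAnd [seq FAllAt 0 (~ (0 ⊆ Var i /\ 0 ⊆ Var j)) | j <- I, i <- iota 1 j.-1]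
     /\ FExAt 0 (is_least d.+1 0 /\ 0 ⊆ 1)
     /\ FAllAt 0 (~ is_greatest d.+1 0 ⟶
          FBigAnd [seq (0 ⊆ Var i ⟶
                       FExAt d.+1 (is_succ d.+2 0 d.+1 /\ d.+1 ⊆ cnext d i)) | i <- I])
     /\ FExAt 0 (is_greatest d.+1 0 /\ 0 ⊆ h)).

(** ρ_(d,h) for an arbitrary integer h: the second argument of [rho] is the
    representative of h modulo d in {1, ..., d}. *)
Definition rho_int (d : nat) (h : int) : formula :=
  rho d (absz (modz (h - 1)%R (Posz d))).+1.

Definition psi_gt (n : nat) : formula :=
  FExSeq (iota 0 n.+1)
    (FBigAnd [seq FAt (Var i) | i <- iota 0 n.+1]
     /\ FBigAnd [seq Var i ≢ Var j | j <- iota 0 n.+1, i <- iota 0 j]).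

Definition T_inf : theory := fun p => exists n, p = psi_gt n.

Close Scope fol_scope.

(** The values [r p j] for p not prime or j = 0, and [rt d] for d <= 1, are
    irrelevant. *)
Definition residue_function2 (r : nat -> nat -> nat) : Prop :=
  forall p j, prime p -> 0 < j ->
    r p j < p ^ j /\ r p j.+1 = r p j %[mod p ^ j].

Definition residue_function (rt : nat -> nat) : Prop :=
  exists2 r, residue_function2 r &
    forall d, 1 < d ->
      rt d < d /\
      forall p j, prime p -> 0 < j -> p ^ j %| d -> rt d = r p j %[mod p ^ j].

Definition T_res (rt : nat -> nat) : theory := fun p =>
  [\/ T_MSOFin p, T_inf p |
      exists2 d, 1 < d & p = rho_int d (Posz (rt d))].

(* Main.v *)
(** A formula p is read as a deterministic automaton whose input at an atom is the
    list of variables containing it (the existential quantifier is a projection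
    followed by the subset construction). In a model of T_MSO(Fin), comprehension
    and well-foundedness give induction along the atoms, so a sentence is accepted
    by the model exactly if the automaton accepts some finite word; hence every
    model agrees with some MSO(n) on any given finite set of sentences. The state
    reached on the word of length n is eventually periodic in n, so that the truth
    of a sentence in an infinite model is decided by one residue of the number of
    atoms, and consistency of residues for different moduli is inherited from the
    finite structures. An ultraproduct of MSO(n_i), where n_i has the prescribed
    residue modulo i!, is a model of T_res. *)
Require Import Defs.
From mathcomp Require Import all_boot all_order all_algebra.
From mathcomp Require Import boolp.
From mathcomp Require filter.
From mathcomp Require Import zify.

Set Implicit Arguments.
Unset Strict Implicit.
Unset Printing Implicit Defensive.

(** * Satisfaction *)

Lemma eq_eval (M : structure) (s s' : nat -> M) t :
  {in fv_term t, s =1 s'} -> eval s t = eval s' t.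
Proof. by case: t => //= x; apply; rewrite inE. Qed.

Lemma eq_sat (M : structure) p (s s' : nat -> M) :
  {in fv p, s =1 s'} -> sat s p <-> sat s' p.
Proof.
elim: p s s' => [t u|t u|t|t u|p IH|p IHp q IHq|x p IH] s s' /= e.
- by rewrite !(@eq_eval M s s') // => y yt; apply: e; rewrite mem_cat yt ?orbT.
- by rewrite !(@eq_eval M s s') // => y yt; apply: e; rewrite mem_cat yt ?orbT.
- by rewrite !(@eq_eval M s s').
- by rewrite !(@eq_eval M s s') // => y yt; apply: e; rewrite mem_cat yt ?orbT.
- by have := IH _ _ e; tauto.
- have /IHp : {in fv p, s =1 s'} by move=> y yt; apply: e; rewrite mem_cat yt.
  have /IHq : {in fv q, s =1 s'}
    by move=> y yt; apply: e; rewrite mem_cat yt orbT.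
  tauto.
- have h a : {in fv p, upd s x a =1 upd s' x a}.
    by move=> y yp; rewrite /upd; case: eqP => // /eqP yx;
       apply: e; rewrite mem_filter yx.
  by split=> -[a /(IH _ _ (h a)) ?]; exists a.
Qed.

Lemma sat_or (M : structure) (s : nat -> M) p q :
  sat s (FOr p q) = (sat s p \/ sat s q).
Proof. by apply/propext => /=; split=> [h|]; [apply: contrapT|]; tauto. Qed.

Lemma sat_imp (M : structure) (s : nat -> M) p q :
  sat s (FImp p q) = (sat s p -> sat s q).
Proof.
apply/propext => /=; split=> [h hp|h [hp]]; last by apply; exact: h.
by apply: contrapT => hq; apply: h.
Qed.

Lemma sat_iff (M : structure) (s : nat -> M) p q :
  sat s (FIff p q) = (sat s p <-> sat s q).
Proof.
apply/propext; rewrite -[X in X <-> _]/(sat s (FImp p q) /\ sat s (FImp q p)).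
by rewrite !sat_imp.
Qed.

Lemma sat_all (M : structure) (s : nat -> M) x p :
  sat s (FAll x p) = (forall a, sat (upd s x a) p).
Proof.
apply/propext => /=; split=> [h a|h [a]]; last by apply.
by apply: contrapT => ha; apply: h; exists a.
Qed.

Definition satE := (sat_or, sat_imp, sat_iff, sat_all).

(** Agrees with [sat] but reads the classical encodings of disjunction,
    implication and universal quantification as the connectives they stand
    for, so that simplification turns a concrete sentence into its meaning. *)
Fixpoint sem (M : structure) (s : nat -> M) (p : formula) : Prop :=
  match p with
  | FEq t u => eval s t = eval s u
  | FSub t u => sub_ (eval s t) (eval s u)
  | FAt t => at_ (eval s t)
  | FLhd t u => lhd_ (eval s t) (eval s u)
  | FNot (FEx x (FNot p)) => forall a : M, sem (upd s x a) p
  | FNot (FAnd (FNot p) (FNot q)) => sem s p \/ sem s q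
  | FNot (FAnd p (FNot q)) => sem s p -> sem s q
  | FNot p => ~ sem s p
  | FAnd p q => sem s p /\ sem s q
  | FEx x p => exists a : M, sem (upd s x a) p
  end.

Lemma satS (M : structure) (s : nat -> M) p : sat s p = sem s p.
Proof.
suff : [/\ sat s p = sem s p, sat s (FNot p) = sem s (FNot p)
  & match p with FNot q => sat s q = sem s q | _ => True end] by case.
elim: p s => [t u|t u|t|t u|p IH|p IHp q IHq|x p IH] s //.
- have [e eN _] := IH s; split=> //.
  by rewrite -[LHS]/(~ sat s (FNot p)) eN.
- have [ep eNp fp] := IHp s; have [eq eNq fq] := IHq s; split=> //=.
    by rewrite ep eq.
  case: q {IHq eNq} eq fq => [t u|t u|t|t u|q|q q'|y q] eq fq;
    try by rewrite ep eq; case: p {IHp ep eNp fp}.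
  have <- : sat s (FImp p q) = (sem s p -> sem s q) by rewrite sat_imp ep fq.
  case: p {IHp eNp ep} fp => //= p <-.
  by rewrite -fq -sat_or.
- have e a := let: And3 e _ _ := IH (upd s x a) in e.
  have eE : sat s (FEx x p) = sem s (FEx x p).
    by rewrite /=; apply/propext; split=> -[a pa]; exists a; move: pa; rewrite e.
  split=> //.
  have eN : sat s (FNot (FEx x p)) = (~ sem s (FEx x p)) by rewrite -eE.
  case: p IH {e eE} eN => [t u|t u|t|t u|p|p q|y p] IH eN; try exact: eN.
  rewrite -[LHS]/(sat s (FAll x p)) sat_all; apply/propext.
  by split=> h a; move: (h a); have [_ _ ->] := IH (upd s x a).
Qed.

Lemma sat_bigand (M : structure) (s : nat -> M) ps :
  sat s (FBigAnd ps) <-> forall p, List.In p ps -> sat s p.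
Proof.
elim: ps => [|q ps IH] /=; first by split.
split=> [[h /IH hs] p [<- //|/hs //]|h]; split; first by apply: h; left.
by apply/IH => p hp; apply: h; right.
Qed.

Lemma sat_bigor (M : structure) (s : nat -> M) ps :
  sat s (FBigOr ps) <-> exists2 p, List.In p ps & sat s p.
Proof.
elim: ps => [|q ps IH]; first by split=> [/= []//|[]].
rewrite -[FBigOr _]/(FOr q (FBigOr ps)) sat_or; split.
  by case=> [h|/IH[p h h']]; [exists q => //; left|exists p => //; right].
by case=> p [->|h] hp; [left|right; apply/IH; exists p].
Qed.

Lemma in_mapP (A : eqType) (B : Type) (f : A -> B) (xs : seq A) (y : B) :
  List.In y [seq f x | x <- xs] <-> exists2 x, x \in xs & f x = y.
Proof.
elim: xs => [|x xs IH] /=; first by split=> // -[].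
split.
  by case=> [<-|/IH[z h h']]; [exists x; rewrite ?mem_head|exists z; rewrite ?inE ?h ?orbT].
case=> z; rewrite inE => /orP[/eqP->|h]; first by left.
by right; apply/IH; exists z.
Qed.

Lemma sat_bigand_map (M : structure) (s : nat -> M) (A : eqType) (f : A -> formula) xs :
  sat s (FBigAnd [seq f x | x <- xs]) <-> {in xs, forall x, sat s (f x)}.
Proof.
rewrite sat_bigand; split=> h; first by move=> x hx; apply: h; apply/in_mapP; exists x.
by move=> p /in_mapP[x hx <-]; exact: h.
Qed.

Lemma sat_bigor_map (M : structure) (s : nat -> M) (A : eqType) (f : A -> formula) xs :
  sat s (FBigOr [seq f x | x <- xs]) <-> exists2 x, x \in xs & sat s (f x).
Proof.
rewrite sat_bigor; split=> [[p /in_mapP[x hx <-] h]|[x hx h]]; first by exists x.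
by exists (f x) => //; apply/in_mapP; exists x.
Qed.

Lemma sat_exseq (M : structure) (s : nat -> M) xs p :
  sat s (FExSeq xs p) <->
  exists2 s', (forall x, x \notin xs -> s' x = s x) & sat s' p.
Proof.
elim: xs s => [|x xs IH] s /=.
  split=> [h|[s' e h]]; first by exists s.
  by have <- : s' = s by apply/funext => y; apply: e.
split=> [[a /IH[s' e h]]|[s' e h]].
  exists s' => // y; rewrite inE negb_or => /andP[yx ys].
  by rewrite e // /upd (negPf yx).
exists (s' x); apply/IH; exists s' => // y ys.
rewrite /upd; case: eqP => [->//|/eqP yx].
by rewrite e // inE negb_or yx.
Qed.

Lemma sat_closure (M : structure) (s : nat -> M) p :
  sat s (univ_closure p) <-> holds M p.
Proof.
suff H xs (r : nat -> M) : sat r (FAllSeq xs p) <->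
    forall s', (forall x, x \notin xs -> s' x = r x) -> sat s' p.
  rewrite H; split=> h r; last by move=> _; exact: h.
  have /eq_sat-> : {in fv p, r =1 fun x => if x \in fv p then r x else s x}.
    by move=> x /= ->.
  by apply: h => x /negPf->.
elim: xs r => [|x xs IH] r.
  split=> [h s' e|]; last by apply.
  by have -> : s' = r by apply/funext => y; apply: e.
rewrite -[FAllSeq _ _]/(FAll x _) sat_all; split=> [h s' e|h a].
  move: (h (s' x)) => /IH; apply=> y ys.
  rewrite /upd; case: eqP => [->//|/eqP yx].
  by rewrite e // inE negb_or yx.
apply/IH => s' e; apply: h => y; rewrite inE negb_or => /andP[yx ys].
by rewrite e // /upd (negPf yx).
Qed.

(** * Models of the base theory *)

Lemma fresh (xs : seq nat) : exists w, w \notin xs.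
Proof.
exists (\max_(x <- xs) x).+1; apply/negP => h.
by have := @leq_bigmax_seq _ xs xpredT (fun x => x) _ h isT; rewrite ltnn.
Qed.

Lemma comprehension (M : structure) (HM : model M T_base) (s : nat -> M) x eta :
  exists A, forall a, at_ a -> (sub_ a A <-> sat (upd s x a) eta).
Proof.
have [X] := fresh (x :: fv eta); rewrite inE negb_or => /andP[/eqP Xx Xeta].
have [A hA] : exists A, sat (upd s X A) (FAllAt x (FIff (FSub x X) eta)).
  by have /sat_closure/(_ s) := HM _ (base_comprehension (not_eq_sym Xx) Xeta) s.
exists A => a aa; move: hA; rewrite /FAllAt sat_all => hA.
move: (hA a); rewrite sat_imp sat_iff /= /upd !eqxx (introF eqP Xx) => /(_ aa) ->.
apply: eq_sat => y ye /=; case: eqP => // _.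
by case: eqP => // yX; rewrite yX (negPf Xeta) in ye.
Qed.

Lemma sub_atomsP (M : structure) (HM : model M T_base) (X Y : M) :
  sub_ X Y <-> forall a, at_ a -> sub_ a X -> sub_ a Y.
Proof.
have S p (h : T_base p) : sem (fun _ => bot_ M) p by rewrite -satS; exact: HM.
have := S _ base_trans; rewrite /= /upd /= => tr.
have := S _ base_refl; rewrite /= /upd /= => rf.
have := S _ base_bot; rewrite /= /upd /= => bt.
split=> [XY a _ aX|h]; first exact: tr (conj aX XY).
have := S _ base_compl; rewrite /= /upd /= => /(_ Y)[C [[_ [_ mC]] [T [topT jC]]]].
have := S _ base_meet; rewrite /= /upd /= => mt.
have [P PE] := mt X Y; have [Q QE] := mt X C.
have := S _ base_distr; rewrite /= /upd /=.
have XT : sub_ X X /\ sub_ X T /\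
    forall w, sub_ w X /\ sub_ w T -> sub_ w X by split=> //; split=> // w [].
move=> /(_ X Y C T X P Q (conj jC (conj XT (conj PE QE))))[_ [_ lub]].
apply: lub; split; first by case: PE => ? [].
have := S _ base_atomic; rewrite /= /upd /= => /(_ Q)[-> //|[a [aa aQ]]].
have [QX [QC _]] := QE.
have aX : sub_ a X by exact: tr (conj aQ QX).
have aB : sub_ a (bot_ M) by apply: mC; split; [exact: h|exact: tr (conj aQ QC)].
have := S _ base_at; rewrite /= /upd /= => /(_ a)[/(_ aa)[aN _] _].
have := S _ base_antisym; rewrite /= /upd /= => as_.
by case: aN; apply: as_.
Qed.

Lemma eq_atomsP (M : structure) (HM : model M T_base) (X Y : M) :
  X = Y <-> forall a, at_ a -> (sub_ a X <-> sub_ a Y).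
Proof.
split=> [->//|h].
have := HM _ base_antisym (fun _ => bot_ M); rewrite satS /= /upd /=; apply.
by split; apply/(sub_atomsP HM) => a aa; move: (h a aa); tauto.
Qed.

Lemma at_subE (M : structure) (HM : model M T_base) (a b : M) :
  at_ a -> at_ b -> sub_ a b -> a = b.
Proof.
have := HM _ base_at (fun _ => bot_ M); rewrite satS /= /upd /= => h.
move=> aa ab ba; have [/(_ ab)[_ /(_ _ ba)[a0|//]] _] := h b.
by have [/(_ aa)[]] := h a.
Qed.

Lemma sub_refl (M : structure) (HM : model M T_base) (a : M) : sub_ a a.
Proof. exact/(sub_atomsP HM). Qed.

Lemma at_bot (M : structure) (HM : model M T_base) (a : M) :
  at_ a -> ~ sub_ a (bot_ M).
Proof.
move=> aa ab.
have := HM _ base_at (fun _ => bot_ M); rewrite satS /= /upd /= => /(_ a)[].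
move=> /(_ aa)[aN _] _; apply: aN.
have := HM _ base_antisym (fun _ => bot_ M); rewrite satS /= /upd /=; apply.
split=> //; have := HM _ base_bot (fun _ => bot_ M); rewrite satS /= /upd /=; apply.
Qed.

Lemma atP (M : structure) (HM : model M T_base) (X : M) :
  at_ X <-> (exists2 a, at_ a & sub_ a X) /\
    (forall a b, at_ a -> at_ b -> sub_ a X -> sub_ b X -> a = b).
Proof.
split=> [aX|[[a aa aX] h]].
  split; first by exists X => //; exact: sub_refl.
  by move=> a b aa ab aXa aXb; rewrite (at_subE HM aa aX) // (at_subE HM ab aX).
suff -> : X = a by [].
apply/(eq_atomsP HM) => b ab; split=> ba; first by rewrite (h b a) //; apply: sub_refl.
by rewrite (at_subE HM ab aa).
Qed.

Lemma lhdP (M : structure) (HM : model M T_base) (X Y : M) :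
  lhd_ X Y <-> exists a b, [/\ at_ a, at_ b, sub_ a X, sub_ b Y & lhd_ a b].
Proof.
have := HM _ base_lhd (fun _ => bot_ M); rewrite satS /= /upd /= => /(_ X Y)[h h'].
split=> [/h[a [aa [b [ab [aX [bY ltab]]]]]]|[a [b [aa ab aX bY ltab]]]].
  by exists a, b.
by apply: h'; exists a; split=> //; exists b.
Qed.

Lemma lhd_irr (M : structure) (HM : model M T_base) (a : M) :
  at_ a -> ~ lhd_ a a.
Proof. by have := HM _ base_lhd_irr (fun _ => bot_ M); rewrite satS; apply. Qed.

Lemma lhd_trans (M : structure) (HM : model M T_base) (b a c : M) :
  at_ a -> at_ b -> at_ c -> lhd_ a b -> lhd_ b c -> lhd_ a c.
Proof.
have := HM _ base_lhd_trans (fun _ => bot_ M); rewrite satS /= /upd /= => h.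
by move=> aa ab ac ltab ltbc; apply: (h a aa b ab c ac).
Qed.

Lemma lhd_total (M : structure) (HM : model M T_base) (a b : M) :
  at_ a -> at_ b -> [\/ lhd_ a b, a = b | lhd_ b a].
Proof.
have := HM _ base_lhd_total (fun _ => bot_ M); rewrite satS /= /upd /= => h.
by move=> aa ab; have [|[]] := h a aa b ab;
   [exact: Or31|exact: Or32|exact: Or33].
Qed.

(** * Finite automata for formulas *)

Definition letter (M : structure) (s : nat -> M) (a : M) : nat -> bool :=
  fun i => `[< sub_ a (s i) >].

Definition leval (l : nat -> bool) (t : term) : bool :=
  if t is Var x then l x else false.

Fixpoint st (p : formula) : finType :=
  match p with
  | FEq _ _ | FSub _ _ => bool
  | FAt _ | FLhd _ _ => (bool * bool)%type
  | FNot p => st p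
  | FAnd p q => (st p * st q)%type
  | FEx _ p => {set st p}
  end.

Fixpoint ini (p : formula) : st p :=
  match p return st p with
  | FEq _ _ | FSub _ _ => true
  | FAt _ | FLhd _ _ => (false, false)
  | FNot p => ini p
  | FAnd p q => (ini p, ini q)
  | FEx _ p => [set ini p]
  end.

Fixpoint step (p : formula) (l : nat -> bool) : st p -> st p :=
  match p return st p -> st p with
  | FEq t u => fun b => b && (leval l t == leval l u)
  | FSub t u => fun b => b && (leval l t ==> leval l u)
  | FAt t => fun b => (b.1 || leval l t, b.2 || b.1 && leval l t)
  | FLhd t u => fun b => (b.1 || leval l t, b.2 || b.1 && leval l u)
  | FNot p => @step p l
  | FAnd p q => fun b => (@step p l b.1, @step q l b.2)
  | FEx x p => fun S => [set @step p (upd l x b) q | q in S, b in {: bool}]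
  end.

Fixpoint acc (p : formula) : pred (st p) :=
  match p return pred (st p) with
  | FEq _ _ | FSub _ _ => id
  | FAt _ => fun b => b.1 && ~~ b.2
  | FLhd _ _ => fun b => b.2
  | FNot p => fun q => ~~ @acc p q
  | FAnd p q => fun b => @acc p b.1 && @acc q b.2
  | FEx x p => fun S => [exists q in S, @acc p q]
  end.

Definition lhd_state (M : structure) (D : M -> Prop) (X Y : M) : bool * bool :=
  (`[< exists2 a, D a & sub_ a X >],
   `[< exists a b, [/\ D a, D b, sub_ a X, sub_ b Y & lhd_ a b] >]).

(** The state reached by the automaton of [p] after reading the atoms in [D];
    unlike a run, it is defined without appealing to induction in [M]. *)
Fixpoint tp (M : structure) (D : M -> Prop) (p : formula) (s : nat -> M) : st p :=
  match p return st p with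
  | FEq t u => `[< forall a, D a -> (sub_ a (eval s t) <-> sub_ a (eval s u)) >]
  | FSub t u => `[< forall a, D a -> sub_ a (eval s t) -> sub_ a (eval s u) >]
  | FAt t => lhd_state D (eval s t) (eval s t)
  | FLhd t u => lhd_state D (eval s t) (eval s u)
  | FNot p => tp D p s
  | FAnd p q => (tp D p s, tp D q s)
  | FEx x p => [set q | `[< exists X, tp D p (upd s x X) = q >]]
  end.

Lemma eq_tp (M : structure) (D : M -> Prop) p (s s' : nat -> M) :
  (forall i a, i \in fv p -> D a -> (sub_ a (s i) <-> sub_ a (s' i))) ->
  tp D p s = tp D p s'.
Proof.
have E xs t (r r' : nat -> M) : {subset fv_term t <= xs} ->
    (forall i a, i \in xs -> D a -> (sub_ a (r i) <-> sub_ a (r' i))) ->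
  forall a, D a -> (sub_ a (eval r t) <-> sub_ a (eval r' t)).
  by case: t => //= x tx h a; apply: h; apply: tx; rewrite inE.
have E2 t u (r r' : nat -> M) : (forall i a, i \in fv_term t ++ fv_term u -> D a ->
       (sub_ a (r i) <-> sub_ a (r' i))) ->
    (forall a, D a -> (sub_ a (eval r t) <-> sub_ a (eval r' t))) /\
    (forall a, D a -> (sub_ a (eval r u) <-> sub_ a (eval r' u))).
  move=> h; split; apply: E h => i it;
    by rewrite mem_cat it ?orbT.
have L t u (r r' : nat -> M) :
    (forall i a, i \in fv_term t ++ fv_term u -> D a ->
       (sub_ a (r i) <-> sub_ a (r' i))) ->
    lhd_state D (eval r t) (eval r u) = lhd_state D (eval r' t) (eval r' u).
  move=> /E2[Et Eu]; congr (_, _); apply: asbool_equiv_eq; split.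
  - by case=> a Da /(Et a Da); exists a.
  - by case=> a Da /(Et a Da); exists a.
  - by case=> a [b [Da Db /(Et a Da) ta /(Eu b Db) ub ltab]]; exists a, b.
  - by case=> a [b [Da Db /(Et a Da) ta /(Eu b Db) ub ltab]]; exists a, b.
elim: p s s' => [t u|t u|t|t u|p IH|p IHp q IHq|x p IH] s s' /= h.
- have [Et Eu] := E2 t u s s' h.
  by apply: asbool_equiv_eq; split=> H a Da; have := H a Da; rewrite (Et a Da) (Eu a Da).
- have [Et Eu] := E2 t u s s' h.
  by apply: asbool_equiv_eq; split=> H a Da; have := H a Da; rewrite (Et a Da) (Eu a Da).
- by apply: L => i a; rewrite mem_cat orbb; exact: h.
- exact: L.
- exact: IH.
- by congr (_, _); [apply: IHp|apply: IHq] => i a ip; apply: h; rewrite mem_cat ip ?orbT.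
- apply/setP => q; rewrite !inE.
  have e X : tp D p (upd s x X) = tp D p (upd s' x X).
    apply: IH => i a ip Da; rewrite /upd; case: eqP => // /eqP ix.
    by apply: h => //; rewrite mem_filter ix.
  by apply: asbool_equiv_eq; split=> -[X <-]; exists X; rewrite e.
Qed.

Lemma tp_empty (M : structure) p (s : nat -> M) : tp (fun _ => False) p s = ini p.
Proof.
have L X Y : lhd_state (fun _ : M => False) X Y = (false, false).
  by congr (_, _); apply/asboolP => -[a]; [|case=> b []].
elim: p s => [t u|t u|t|t u|p IH|p IHp q IHq|x p IH] s //=.
- exact/asboolP.
- exact/asboolP.
- by rewrite IHp IHq.
- apply/setP => q; rewrite !inE; apply/asboolP/eqP => [[X <-]//|->].
  by exists (s x).
Qed.

Lemma leval_letter (M : structure) (HM : model M T_base) (s : nat -> M) a t :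
  at_ a -> leval (letter s a) t = `[< sub_ a (eval s t) >].
Proof. by case: t => //= aa; apply/esym/asboolPn; exact: at_bot. Qed.

Lemma letter_upd (M : structure) (s : nat -> M) x (X a : M) :
  letter (upd s x X) a = upd (letter s a) x `[< sub_ a X >].
Proof. by apply/funext => i; rewrite /letter /upd; case: eqP. Qed.

Lemma insert_atom (M : structure) (HM : model M T_base) (X a : M) (b : bool) :
  at_ a -> exists Y, (sub_ a Y <-> b) /\
    forall c, at_ c -> c <> a -> (sub_ c Y <-> sub_ c X).
Proof.
move=> aa; pose s := upd (fun _ => X) 1 a.
have [Y hY] := comprehension HM s 2
  (if b then FOr (FSub 2 0) (FEq 2 1) else FAnd (FSub 2 0) (FNeq 2 1)).
exists Y; split=> [|c ac ca].
  rewrite hY //; case: b {hY}; rewrite satS /= /upd /=.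
    by split=> // _; right.
  by split=> // -[_ []].
by rewrite hY //; case: b {hY}; rewrite satS /= /upd /=; tauto.
Qed.

Lemma lhd_state_step (M : structure) (HM : model M T_base) (D : M -> Prop) (a X Y : M) :
  at_ a -> (forall x, D x -> at_ x /\ lhd_ x a) ->
  let b := lhd_state D X Y in
  lhd_state (fun x => D x \/ x = a) X Y =
    (b.1 || `[< sub_ a X >], b.2 || b.1 && `[< sub_ a Y >]).
Proof.
move=> aa hD; congr (_, _); apply/asboolP/orP => /=.
- case=> x [Dx|->] xX; first by left; apply/asboolP; exists x.
  by right; apply/asboolP.
- by case=> /asboolP; [case=> x Dx xX; exists x => //; left|exists a => //; right].
- case=> x [y] [[Dx|->] [Dy|->] xX yY lxy].
  + by left; apply/asboolP; exists x, y.
  + by right; apply/andP; split; apply/asboolP => //; exists x.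
  + have [ay lya] := hD y Dy.
    by case: (lhd_irr HM aa); exact: (lhd_trans HM aa ay aa lxy lya).
  + by case: (lhd_irr HM aa).
- case.
    by case/asboolP=> x [y] [Dx Dy ? ? ?]; exists x, y; split=> //; left.
  case/andP=> /asboolP[x Dx xX] /asboolP aY; have [_ lxa] := hD x Dx.
  by exists x, a; split=> //; [left|right].
Qed.

Lemma tp_step (M : structure) (HM : model M T_base) (D : M -> Prop) (a : M) p s :
  at_ a -> (forall x, D x -> at_ x /\ lhd_ x a) ->
  tp (fun x => D x \/ x = a) p s = step (letter s a) (tp D p s).
Proof.
move=> aa hD.
elim: p s => [t u|t u|t|t u|p IH|p IHp q IHq|x p IH] s /=.
- rewrite !leval_letter //; apply/asboolP/andP.
    move=> h; split; first by apply/asboolP => x Dx; apply: h; left.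
    by apply/eqP; apply: asbool_equiv_eq; apply: h; right.
  by case=> /asboolP h /eqP e x [Dx|->]; [exact: h|exact: asbool_eq_equiv].
- rewrite !leval_letter //; apply/asboolP/andP.
    move=> h; split; first by apply/asboolP => x Dx; apply: h; left.
    by apply/implyP => /asboolP h'; apply/asboolP; apply: h => //; right.
  case=> /asboolP h /implyP h' x [Dx|->] ax; first exact: h ax.
  by apply/asboolP/h'/asboolP.
- by rewrite lhd_state_step // leval_letter.
- by rewrite lhd_state_step // !leval_letter.
- by rewrite IH.
- by rewrite IHp IHq.
- apply/setP => q'; rewrite !inE; apply/asboolP/imset2P.
    case=> X <-; rewrite IH letter_upd.
    exists (tp D p (upd s x X)) `[< sub_ a X >] => //.
    by rewrite inE; apply/asboolP; exists X.
  case=> q b; rewrite inE => /asboolP[X <-] _ ->.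
  have [Y [aY YX]] := insert_atom HM X b aa.
  exists Y; rewrite IH letter_upd.
  have -> : `[< sub_ a Y >] = b by apply/asboolP/idP; rewrite aY.
  congr step; apply: eq_tp => i c _ Dc; rewrite /upd; case: eqP => // _.
  have [ac lca] := hD c Dc; apply: YX => // ca.
  by case: (lhd_irr HM aa); rewrite -{1}ca.
Qed.

Lemma acc_tp (M : structure) (HM : model M T_base) p (s : nat -> M) :
  acc (tp (@at_ M) p s) <-> sat s p.
Proof.
elim: p s => [t u|t u|t|t u|p IH|p IHp q IHq|x p IH] s /=.
- by rewrite (eq_atomsP HM); split=> [/asboolP//|h]; exact/asboolP.
- by rewrite (sub_atomsP HM); split=> [/asboolP//|h]; exact/asboolP.
- rewrite (atP HM); split.
    case/andP=> /asboolP h /asboolPn h'; split=> // a b aa ab aX bX.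
    by have [ltab|//|ltba] := lhd_total HM aa ab; case: h'; [exists a, b|exists b, a].
  case=> h h'; apply/andP; split; first exact/asboolP.
  apply/asboolPn => -[a [b [aa ab aX bX ltab]]].
  by apply: (lhd_irr HM aa); rewrite {2}(h' a b).
- by rewrite (lhdP HM); split=> [/asboolP//|h]; exact/asboolP.
- by rewrite -IH; split=> /negP.
- by rewrite -IHp -IHq; split=> /andP.
- split=> [/existsP[q /andP[]]|[X /IH h]].
    by rewrite inE => /asboolP[X <-] /IH; exists X.
  by apply/existsP; exists (tp (@at_ M) p (upd s x X)); rewrite h andbT inE;
     apply/asboolP; exists X.
Qed.

(** * Induction along the atoms *)

Definition definable (M : structure) (P : (nat -> M) -> Prop) :=
  exists f, forall s, sat s f <-> P s.

Definition down (M : structure) (a : M) : M -> Prop :=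
  fun x => at_ x /\ (x = a \/ lhd_ x a).

Lemma eval_fresh (M : structure) (s : nat -> M) w X t :
  w \notin fv_term t -> eval (upd s w X) t = eval s t.
Proof. by case: t => //= x; rewrite inE /upd eq_sym => /negPf->. Qed.

Lemma definable_eq (M : structure) (P : (nat -> M) -> Prop) (b : bool) :
  definable P -> definable (fun s => `[< P s >] = b).
Proof.
case=> f hf; exists (if b then f else FNot f) => s; case: b => /=; rewrite hf.
  by split=> /asboolP.
by split=> [h|/negbT/asboolPn//]; apply/negbTE/asboolPn.
Qed.

Lemma definable_and (M : structure) (P Q : (nat -> M) -> Prop) :
  definable P -> definable Q -> definable (fun s => P s /\ Q s).
Proof. by case=> f hf [g hg]; exists (FAnd f g) => s /=; rewrite hf hg. Qed.

Lemma definable_lhd_state (M : structure) t u v b :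
  definable (fun s : nat -> M =>
    lhd_state (down (s v)) (eval s t) (eval s u) = b).
Proof.
have [w] := fresh (v :: fv_term t ++ fv_term u).
rewrite inE mem_cat !negb_or => /and3P[wv wt wu].
have [z] := fresh (w :: v :: fv_term t ++ fv_term u).
rewrite !inE mem_cat !negb_or => /and4P[zw zv zt zu].
pose F x := FAnd (FAt (Var x)) (FOr (FEq x v) (FLhd x v)).
have downE (s : nat -> M) x : sat s (F x) <-> down (s v) (s x).
  by rewrite /F satS.
have vw := negPf wv; have vz := negPf zv; rewrite eq_sym in vw; rewrite eq_sym in vz.
have wz := negPf zw; rewrite eq_sym in wz.
suff h : definable (fun s : nat -> M =>
    `[< exists2 a, down (s v) a & sub_ a (eval s t) >] = b.1 /\
    `[< exists a c, [/\ down (s v) a, down (s v) c, sub_ a (eval s t),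
           sub_ c (eval s u) & lhd_ a c] >] = b.2).
  case: h => f hf; exists f => s; rewrite hf /lhd_state.
  by case: b {hf} => b1 b2 /=; split=> [[-> ->]|[]].
apply: definable_and; apply: definable_eq.
  exists (FEx w (FAnd (F w) (FSub w t))) => s; split.
    case=> X [/downE]; rewrite /= eval_fresh // /upd eqxx vw.
    by exists X.
  case=> X dX hX; exists X; split; first by apply/downE; rewrite /upd eqxx vw.
  by rewrite /= eval_fresh // /upd eqxx.
exists (FEx w (FEx z (FAnd (F w) (FAnd (F z)
  (FAnd (FSub w t) (FAnd (FSub z u) (FLhd w z))))))) => s; split.
  case=> X [Y [/downE hX [/downE hY]]]; rewrite /= !eval_fresh //.
  move: hX hY; rewrite /upd !eqxx vw vz wz => hX hY [hXt [hYu hXY]].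
  by exists X, Y.
case=> X [Y [dX dY hX hY hXY]]; exists X, Y.
split; first by apply/downE; rewrite /upd !eqxx vw vz wz.
split; first by apply/downE; rewrite /upd !eqxx vw vz.
by rewrite /= !eval_fresh // /upd !eqxx wz.
Qed.

Lemma definable_tp (M : structure) p :
  exists N, forall v, N <= v -> forall q,
    definable (fun s : nat -> M => tp (down (s v)) p s = q).
Proof.
elim: p => [t u|t u|t|t u|p [N IH]|p [N IHp] q [N' IHq]|x p [N IH]].
- exists 0 => v _ b /=; apply: definable_eq.
  have [w] := fresh (v :: fv_term t ++ fv_term u).
  rewrite inE mem_cat !negb_or eq_sym => /and3P[/negPf vw wt wu].
  exists (FAllAt w (FImp (FOr (FEq w v) (FLhd w v)) (FIff (FSub w t) (FSub w u)))) => s.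
  rewrite /FAllAt sat_all; split=> [h X [aX dX]|h X].
    move: (h X); rewrite !satE /= !eval_fresh // /upd !eqxx vw; exact.
  rewrite !satE /= !eval_fresh // /upd !eqxx vw => aX dX.
  exact: h.
- exists 0 => v _ b /=; apply: definable_eq.
  have [w] := fresh (v :: fv_term t ++ fv_term u).
  rewrite inE mem_cat !negb_or eq_sym => /and3P[/negPf vw wt wu].
  exists (FAllAt w (FImp (FOr (FEq w v) (FLhd w v)) (FImp (FSub w t) (FSub w u)))) => s.
  rewrite /FAllAt sat_all; split=> [h X [aX dX]|h X].
    move: (h X); rewrite !satE /= !eval_fresh // /upd !eqxx vw; exact.
  rewrite !satE /= !eval_fresh // /upd !eqxx vw => aX dX.
  exact: h.
- by exists 0 => v _ b; apply: definable_lhd_state.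
- by exists 0 => v _ b; apply: definable_lhd_state.
- by exists N.
- exists (maxn N N') => v; rewrite geq_max => /andP[Nv N'v] [b c] /=.
  have [f hf] := definable_and (IHp v Nv b) (IHq v N'v c).
  by exists f => s; rewrite hf; split=> [[-> ->]|[]].
- exists (maxn N x.+1) => v; rewrite geq_max => /andP[Nv xv] S /=.
  have [F hF] := choice (IH v Nv).
  pose G q := if q \in S then FEx x (F q) else FNot (FEx x (F q)).
  exists (FBigAnd [seq G q | q <- enum (st p)]) => s.
  rewrite sat_bigand_map.
  have e q : sat s (FEx x (F q)) <-> exists X, tp (down (s v)) p (upd s x X) = q.
    have vx X : upd s x X v = s v by rewrite /upd gtn_eqF.
    by split=> -[X h]; exists X; have := hF q (upd s x X); rewrite vx => hq;
       apply/hq.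
  split=> [h|eS q _].
    apply/setP => q; rewrite inE; have := h q; rewrite mem_enum => /(_ isT).
    rewrite /G; case: ifP => _; first by move/e/asboolP.
    by move=> h'; apply/asboolPn => /e.
  rewrite /G -eS inE; case: asboolP => h; first exact/e.
  by move/e.
Qed.

Lemma atom_ind (M : structure) (HM : model M T_MSOFin) (s : nat -> M) v P :
  definable P ->
  (forall a, at_ a -> (forall b, at_ b -> b = a \/ lhd_ a b) -> P (upd s v a)) ->
  (forall a b, at_ a -> at_ b -> lhd_ a b ->
     (forall c, at_ c -> lhd_ a c -> lhd_ c b -> False) ->
     P (upd s v a) -> P (upd s v b)) ->
  forall a, at_ a -> P (upd s v a).
Proof.
case=> f hf P0 PS a aa.
have HB : model M T_base by move=> p /fin_base/HM.
have [Z hZ] := comprehension HB s v (FNot f).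
have {}hZ x : at_ x -> (sub_ x Z <-> ~ P (upd s v x)) by move=> /hZ->; rewrite /= hf.
apply: contrapT => /hZ-/(_ aa) aZ.
have := HM _ fin_wf (fun _ => bot_ M); rewrite satS /= /upd /= => /(_ Z)[Z0|].
  by apply: (at_bot HB aa); rewrite -Z0.
case=> b [ab [/(hZ b ab) Pb lb]]; apply: Pb.
have := HM _ fin_pred (fun _ => bot_ M); rewrite satS /= /upd /= => /(_ b ab).
case=> [[_ b0]|[c [ac [lcb cb]]]]; first exact: P0.
apply: (PS c) => // [d ad lcd ldb|]; first by apply: cb; exists d.
apply: contrapT => /(hZ c ac)/(lb c ac)[cE|lbc].
  by apply: (lhd_irr HB ab); rewrite -{1}cE.
exact: (lhd_irr HB ab (lhd_trans HB ab ac ab lbc lcb)).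
Qed.

(** * Transfer between finite and arbitrary models *)

Definition null_step (p : formula) : st p -> st p := @step p (fun _ => false).

Definition word_state (p : formula) n : st p := iter n (@null_step p) (ini p).

Lemma letter_bot (M : structure) (HM : model M T_base) (a : M) :
  at_ a -> letter (fun _ => bot_ M) a = fun _ => false.
Proof. by move=> aa; apply/funext => i; apply/asboolPn; exact: at_bot. Qed.

Lemma tp_null_step (M : structure) (HM : model M T_base) (D : M -> Prop) a p :
  at_ a -> (forall x, D x -> at_ x /\ lhd_ x a) ->
  tp (fun x => D x \/ x = a) p (fun _ => bot_ M) =
  null_step (tp D p (fun _ => bot_ M)).
Proof. by move=> aa hD; rewrite tp_step // letter_bot. Qed.

Lemma word_state_down (M : structure) (HM : model M T_MSOFin) p a : at_ a ->
  exists n, tp (down a) p (fun _ => bot_ M) = word_state p n.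
Proof.
set s := fun _ => bot_ M => aa.
have HB : model M T_base by move=> q /fin_base/HM.
have [N hN] := definable_tp M p.
have [v] := fresh (fv p ++ iota 0 N).
rewrite mem_cat mem_iota add0n negb_or /= -leqNgt => /andP[vp Nv].
have [F hF] := choice (hN v Nv).
pose P (r : nat -> M) := exists n, tp (down (r v)) p r = word_state p n.
have PE x : P (upd s v x) <-> exists n, tp (down x) p s = word_state p n.
  rewrite /P {1}/upd eqxx; have <- // : tp (down x) p s = tp (down x) p (upd s v x).
  by apply: eq_tp => i y ip _; rewrite /upd; case: eqP => // iv; rewrite iv (negPf vp) in ip.
apply/PE; apply: (@atom_ind M HM s v P) => //.
- exists (FBigOr [seq F q | q <- [seq q <- enum (st p) |
                                   `[< exists n, q = word_state p n >]]]) => r.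
  rewrite sat_bigor_map; split=> [[q]|[n hn]].
    by rewrite mem_filter => /andP[/asboolP[n ->] _] /hF hq; exists n.
  exists (word_state p n); last exact/hF.
  by rewrite mem_filter mem_enum andbT; apply/asboolP; exists n.
- move=> b ab bmin; apply/PE; exists 1.
  rewrite /word_state /= -(tp_empty p s) -(@tp_null_step _ HB _ b) //; congr (tp _ p s).
  apply/funext => x; apply/propext; split=> [[ax [->|lxb]]|[//|->]];
    [by right| |by split=> //; left].
  have [->|lbx] := bmin x ax; first by right.
  by case: (lhd_irr HB ab (lhd_trans HB ab ax ab lbx lxb)).
- move=> b c ab ac lbc bc /PE[n hn]; apply/PE; exists n.+1.
  rewrite /word_state iterS -[iter _ _ _]/(word_state p n) -hn -(@tp_null_step _ HB _ c) //.
    congr (tp _ p s); apply/funext => x; apply/propext; split.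
      case=> ax [->|lxc]; first by right.
      left; split=> //; have [|->|lbx] := lhd_total HB ax ab; [by right|by left|].
      by case: (bc x).
    case=> [[ax h]|->]; last by split=> //; left.
    by split=> //; right; case: h => [->//|lxb]; exact: (lhd_trans HB ax ab ac).
  by move=> x [ax [->|lxb]]; split=> //; exact: (lhd_trans HB ax ab ac).
Qed.

Lemma word_state_at (M : structure) (HM : model M T_MSOFin) p :
  exists n, tp (@at_ M) p (fun _ => bot_ M) = word_state p n.
Proof.
have [[a aa]|h] := pselect (exists a : M, at_ a); last first.
  exists 0; rewrite /word_state /= -(tp_empty p (fun _ => bot_ M)); congr (tp _ p _).
  by apply/funext => x; apply/propext; split=> // ax; case: h; exists x.
have := HM _ fin_endpoints (fun _ => bot_ M); rewrite satS /= /upd /=.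
case=> [|_ [b [ab bmax]]]; first by exists a.
have [n hn] := word_state_down HM p ab; exists n; rewrite -hn; congr (tp _ p _).
apply/funext => x; apply/propext; split=> [ax|[]//].
by split=> //; exact: bmax.
Qed.

Lemma MSO_lhd1 n (i j : 'I_n) : lhd_ ([set i] : MSO n) [set j] <-> i < j.
Proof.
split=> [[a [b []]]|ij]; first by rewrite !inE => /eqP-> /eqP->.
by exists i, j; rewrite !inE.
Qed.

Lemma MSO_comprehension n x X eta : x <> X -> X \notin fv eta ->
  holds (MSO n) (univ_closure (FEx X (FAllAt x (FIff (FSub x X) eta)))).
Proof.
move=> xX Xeta s; apply/sat_closure => {}s.
exists [set i | `[< sat (upd s x ([set i] : MSO n)) eta >]].
set A := finset _.
rewrite -/(sat (upd s X (A : MSO n)) (FAllAt x _)) /FAllAt sat_all.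
move=> B; rewrite sat_imp sat_iff /= /upd !eqxx (introF eqP (not_eq_sym xX)).
case=> i ->; rewrite sub1set inE.
have e : sat (upd s x ([set i] : MSO n)) eta <->
    sat (upd (upd s X (A : MSO n)) x ([set i] : MSO n)) eta.
  apply: eq_sat => y ye; rewrite /upd; case: eqP => // _.
  by case: eqP => // yX; rewrite yX (negPf Xeta) in ye.
by split=> [/asboolP/e|/e/asboolP].
Qed.

Lemma MSO_base n : model (MSO n) T_base.
Proof.
move=> p; case=> [|||||||||||||||x X eta xX Xeta] s;
  last exact: MSO_comprehension.
all: rewrite satS /= /upd /=.
- by [].
- by move=> X Y [XY YX]; apply/eqP; rewrite eqEsubset XY.
- by move=> X Y Z [XY YZ]; exact: subset_trans YZ.
- by move=> X; exact: sub0set.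
- by exists setT => X; exact: subsetT.
- move=> X Y; exists (X :&: Y); split; first exact: subsetIl.
  split; first exact: subsetIr.
  by move=> Z [ZX ZY]; rewrite subsetI ZX.
- move=> X Y; exists (X :|: Y); split; first exact: subsetUl.
  split; first exact: subsetUr.
  by move=> Z [ZX ZY]; rewrite subUset ZX.
- move=> X Y Z J P Q R [[YJ [ZJ lJ]] [[PX [PJ gP]] [[QX [QY gQ]] [RX [RZ gR]]]]].
  split; first by apply: gP; split=> //; exact: subset_trans YJ.
  split; first by apply: gP; split=> //; exact: subset_trans ZJ.
  move=> W [QW RW].
  have JU : J \subset Y :|: Z by apply: lJ; rewrite subsetUl subsetUr.
  have YQ : X :&: Y \subset Q by apply: gQ; rewrite subsetIl subsetIr.
  have ZR : X :&: Z \subset R by apply: gR; rewrite subsetIl subsetIr.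
  apply/subsetP => i iP; have iX := subsetP PX i iP.
  have := subsetP JU i (subsetP PJ i iP); rewrite inE => /orP[iY|iZ].
    by apply: (subsetP QW); apply: (subsetP YQ); rewrite inE iX.
  by apply: (subsetP RW); apply: (subsetP ZR); rewrite inE iX.
- move=> X; exists (~: X); split.
    split; first exact: sub0set.
    split; first exact: sub0set.
    by move=> W [WX WC]; rewrite -(setICr X) subsetI WX.
  exists setT; split; first by move=> W; exact: subsetT.
  split; first exact: subsetT.
  split; first exact: subsetT.
  by move=> W [XW CW]; rewrite -(setUCr X) subUset XW.
- move=> X; split.
    case=> i ->; split=> [/setP/(_ i)|Y]; first by rewrite !inE eqxx.
    by rewrite subset1 => /orP[]/eqP->; [right|left].
  case=> /eqP/set0Pn[i iX] h; exists i.
  have siX : [set i] \subset X by rewrite sub1set.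
  have [/setP/(_ i)|//] := h _ siX.
  by rewrite !inE eqxx.
- move=> X; have [->|[i iX]] := set_0Vmem X; [by left|right].
  by exists [set i]; split; [exists i|rewrite sub1set].
- by move=> _ [i ->] /MSO_lhd1; rewrite ltnn.
- move=> _ [i ->] _ [j ->] _ [k ->] [/MSO_lhd1 ij /MSO_lhd1 jk].
  by apply/MSO_lhd1; exact: ltn_trans jk.
- move=> _ [i ->] _ [j ->]; have [ij|ji|ij] := ltngtP i j.
  + by left; apply/MSO_lhd1.
  + by right; right; apply/MSO_lhd1.
  + by right; left; congr [set _]; exact: val_inj.
- move=> X Y; split.
    case=> i [j [iX jY ij]]; exists [set i]; split; first by exists i.
    exists [set j]; split; first by exists j.
    by rewrite !sub1set; split=> //; split=> //; apply/MSO_lhd1.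
  case=> _ [[i ->] [_ [[j ->] []]]]; rewrite sub1set => iX [].
  by rewrite sub1set => jY /MSO_lhd1 ij; exists i, j.
Qed.

Lemma MSO_Fin n : model (MSO n) T_MSOFin.
Proof.
move=> p; case=> [{}p||||]; first exact: MSO_base.
all: move=> s; rewrite satS /= /upd /=.
- case=> _ [i _]; have n0 : 0 < n by case: (n) i => [[]|].
  split.
    exists [set Ordinal n0]; split; first by exists (Ordinal n0).
    move=> _ [j ->]; have [j0|j0] := posnP j.
      by left; congr [set _]; exact: val_inj.
    by right; apply/MSO_lhd1.
  have n1 : n.-1 < n by rewrite prednK.
  exists [set Ordinal n1]; split; first by exists (Ordinal n1).
  move=> _ [j ->]; have : j <= n.-1 by rewrite -ltnS prednK.
  rewrite leq_eqVlt => /orP[/eqP j0|j0].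
    by left; congr [set _]; exact: val_inj.
  by right; apply/MSO_lhd1.
- move=> _ [i ->]; have [ni|ni] := leqP n i.+1; [left|right].
    split; first by exists i.
    move=> _ [j ->]; have : j <= i by rewrite -ltnS (leq_trans _ ni).
    rewrite leq_eqVlt => /orP[/eqP j0|j0].
      by left; congr [set _]; exact: val_inj.
    by right; apply/MSO_lhd1.
  exists [set Ordinal ni]; split; first by exists (Ordinal ni).
  split; first by apply/MSO_lhd1.
  case=> _ [[k ->] [/MSO_lhd1 ik /MSO_lhd1]] /=; rewrite ltnS => ki.
  by have := leq_trans ik ki; rewrite ltnn.
- move=> _ [i ->]; have [i0|i0] := posnP i; [left|right].
    split; first by exists i.
    move=> _ [j ->]; have [j0|j0] := posnP j.
      by left; congr [set _]; apply: val_inj; rewrite /= i0.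
    by right; apply/MSO_lhd1; rewrite i0.
  have ni : i.-1 < n by rewrite prednK // ltnW.
  exists [set Ordinal ni]; split; first by exists (Ordinal ni).
  split; first by apply/MSO_lhd1; rewrite /= prednK.
  case=> _ [[k ->] [/MSO_lhd1 /= ik /MSO_lhd1]]; rewrite prednK // in ik.
  by rewrite ltnNge ik.
- move=> X; have [->|[i iX]] := set_0Vmem X; [by left|right].
  have [j jX jmin] := @arg_minnP _ i (mem X) (@nat_of_ord n) iX.
  exists [set j]; split; first by exists j.
  split; first by rewrite sub1set.
  move=> _ [k ->]; rewrite sub1set => kX.
  have := jmin k kX; rewrite leq_eqVlt => /orP[/eqP jk|jk].
    by left; congr [set _]; exact: val_inj.
  by right; apply/MSO_lhd1.
Qed.

Lemma word_state_MSO n p :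
  tp (@at_ (MSO n)) p (fun _ => bot_ (MSO n)) = word_state p n.
Proof.
pose D k (X : MSO n) := exists2 i : 'I_n, i < k & X = [set i].
have -> : @at_ (MSO n) = D n.
  by apply/funext => X; apply/propext; split=> [[i ->]|[i _ ->]]; exists i.
suff H k : k <= n -> tp (D k) p (fun _ => bot_ (MSO n)) = word_state p k by exact: H.
elim: k => [_|k IH kn].
  rewrite /word_state /= -(tp_empty p (fun _ => bot_ (MSO n))); congr (tp _ p _).
  by apply/funext => X; apply/propext; split=> // -[].
rewrite /word_state iterS -[iter _ _ _]/(word_state p k) -IH ?(ltnW kn) //.
rewrite -(@tp_null_step _ (@MSO_base n) (D k) [set Ordinal kn]).
- congr (tp _ p _); apply/funext => X; apply/propext; split.
    case=> i; rewrite ltnS leq_eqVlt => /orP[/eqP ik|ik] ->; last by left; exists i.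
    by right; congr [set _]; exact: val_inj.
  case=> [[i ik ->]|->]; first by exists i => //; exact: ltnW.
  by exists (Ordinal kn).
- by exists (Ordinal kn).
- by move=> _ [i ik ->]; split; [exists i|apply/MSO_lhd1].
Qed.

Lemma holdsE (M : structure) (HM : model M T_base) p :
  holds M p <-> acc (tp (@at_ M) (univ_closure p) (fun _ => bot_ M)).
Proof. by rewrite (acc_tp HM) sat_closure. Qed.

Lemma holds_MSO n p : holds (MSO n) p <-> acc (word_state (univ_closure p) n).
Proof. by rewrite -word_state_MSO; exact/holdsE/MSO_base. Qed.

(** The state of one conjunction determines the states of its conjuncts, so a
    single [n] serves finitely many formulas. *)
Lemma pseudofinite (M : structure) (HM : model M T_MSOFin) ps :
  exists n, forall p, List.In p ps -> (holds M p <-> holds (MSO n) p).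
Proof.
have HB : model M T_base by move=> p /fin_base/HM.
pose q := FBigAnd [seq univ_closure p | p <- ps].
have [n hn] := word_state_at HM q; exists n.
move: hn; rewrite {}/q -word_state_MSO; elim: ps => //= p ps IH [hp /IH h] q.
case=> [<-|/h//].
by rewrite !holdsE ?hp //; exact: MSO_base.
Qed.

Lemma iter_periodic (T : finType) (f : T -> T) x :
  exists c d, 0 < d /\ forall n, c <= n -> iter (n + d) f x = iter n f x.
Proof.
have : ~~ injectiveb (fun i : 'I_#|T|.+1 => iter i f x).
  by apply/injectiveP => /leq_card; rewrite card_ord ltnn.
case/injectivePn => i [j ij e].
wlog lij : i j ij e / i < j.
  move=> H; have [|ji|/val_inj ji] := ltngtP i j; first exact: H ij e.
    by apply: (H j i) => //; rewrite eq_sym.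
  by rewrite ji eqxx in ij.
exists i, (j - i); rewrite subn_gt0; split=> // n ni.
rewrite -{1}(subnK ni) -addnA subnKC ?(ltnW lij) //.
by rewrite iterD -e -iterD subnK.
Qed.

Lemma MSO_periodic p : exists c d, 1 < d /\ forall m n,
  c <= m -> c <= n -> m = n %[mod d] -> (holds (MSO m) p <-> holds (MSO n) p).
Proof.
have [c [d [d0 per]]] := iter_periodic (@null_step (univ_closure p)) (ini _).
have perk k n : c <= n -> word_state (univ_closure p) (n + k * d) =
    word_state (univ_closure p) n.
  elim: k n => [|k IH] n cn; first by rewrite addn0.
  by rewrite mulSn addnA IH ?(leq_trans cn) ?leq_addr // /word_state per.
exists c, d.*2; split; first by rewrite -addnn; lia.
move=> m n; wlog mn : m n / m <= n.
  by move=> H cm cn e; case/orP: (leq_total m n) => h; [|symmetry]; exact: H.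
move=> cm cn /esym/eqP; rewrite eqn_mod_dvd // => /dvdnP[k nm].
have -> : n = m + (k * 2) * d by lia.
by rewrite !holds_MSO perk.
Qed.

(** * The sentences [psi_gt] and [rho] in finite models *)

Lemma upd_eq (D : Type) (s : nat -> D) x a : upd s x a x = a.
Proof. by rewrite /upd eqxx. Qed.

Lemma sat_and (M : structure) (s : nat -> M) p q :
  sat s (FAnd p q) = (sat s p /\ sat s q).
Proof. by []. Qed.

Lemma sat_bigand_cat (M : structure) (s : nat -> M) ps qs :
  sat s (FBigAnd (ps ++ qs)) <-> sat s (FBigAnd ps) /\ sat s (FBigAnd qs).
Proof. by elim: ps => [|p ps /= ->] /=; tauto. Qed.

Lemma sat_bigand_pairs (M : structure) (s : nat -> M) (f : nat -> nat -> formula)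
    (t : nat -> seq nat) xs :
  sat s (FBigAnd [seq f i j | i <- xs, j <- t i]) <->
  {in xs, forall i, {in t i, forall j, sat s (f i j)}}.
Proof.
elim: xs => [|x xs IH] /=; first by split.
rewrite sat_bigand_cat IH sat_bigand_map; split=> [[h h'] i|h].
  by rewrite inE => /orP[/eqP->|/h'].
split; first by apply: h; rewrite mem_head.
by move=> i hi; apply: h; rewrite inE hi orbT.
Qed.

Lemma MSO_psi n m : holds (MSO n) (psi_gt m) <-> m < n.
Proof.
split=> [/(_ (fun _ => bot_ (MSO n)))|mn s].
  rewrite sat_exseq => -[s' _]; rewrite sat_and => -[/sat_bigand_map h1 /sat_bigand_pairs h2].
  have /choice[f hf] (k : 'I_m.+1) : exists i : 'I_n, s' k = [set i].
    by apply: (h1 k); rewrite mem_iota ltn_ord.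
  have finj : injective f.
    move=> k k' e; apply: val_inj => /=; have {}e : s' k = s' k' by rewrite !hf e.
    have [kk|kk|//] := ltngtP k k'.
      by case: (h2 k' _ k) => //; rewrite mem_iota add0n ?kk ?ltn_ord.
    by case: (h2 k _ k') => //; rewrite mem_iota add0n ?kk ?ltn_ord.
  by have := leq_card f finj; rewrite !card_ord.
case: n mn s => // n; rewrite ltnS => mn s.
apply/sat_exseq; exists (fun i => if i <= m then [set inord i] else s i).
  by move=> i; rewrite mem_iota add0n ltnS /= => /negPf->.
rewrite sat_and; split.
  apply/sat_bigand_map => i; rewrite mem_iota add0n ltnS /= => im.
  by exists (inord i); rewrite im.
apply/sat_bigand_pairs => j; rewrite mem_iota add0n ltnS /= => jm i.
rewrite mem_iota add0n => /= ij; rewrite jm (ltnW (leq_trans ij jm)).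
move=> /set1_inj/(congr1 val) /=; rewrite !inordK ?ltnS ?(leq_trans _ mn) //.
  by move=> e; rewrite e ltnn in ij.
exact: ltnW (leq_trans ij jm).
Qed.

Lemma sat_least n (s : nat -> MSO n) w x (a : 'I_n) : w != x ->
  s x = [set a] -> sat s (is_least w x) <-> a = 0 :> nat.
Proof.
move=> wx sx; rewrite satS /= /upd eqxx eq_sym (negPf wx) sx.
split=> [[_ h]|a0].
  have n0 : 0 < n by exact: leq_ltn_trans (ltn_ord a).
  have [|/set1_inj<- //|/MSO_lhd1 //] := h [set Ordinal n0].
  by exists (Ordinal n0).
split; first by exists a.
move=> _ [b ->]; have [b0|b0] := posnP b.
  by left; congr [set _]; apply: val_inj; rewrite /= a0 b0.
by right; apply/MSO_lhd1; rewrite a0.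
Qed.

Lemma sat_greatest n (s : nat -> MSO n) w x (a : 'I_n) : w != x ->
  s x = [set a] -> sat s (is_greatest w x) <-> a.+1 = n.
Proof.
move=> wx sx; rewrite satS /= /upd eqxx eq_sym (negPf wx) sx.
split=> [[_ h]|an].
  have n1 : n.-1 < n by rewrite ltn_predL; exact: leq_ltn_trans (ltn_ord a).
  have [|/set1_inj<- /=|/MSO_lhd1 /=] := h [set Ordinal n1].
  - by exists (Ordinal n1).
  - by rewrite prednK //; exact: leq_ltn_trans n1.
  - by have := ltn_ord a; lia.
split; first by exists a.
move=> _ [b ->]; have := ltn_ord b; rewrite -{2}an ltnS leq_eqVlt => /orP[/eqP ba|ba].
  by left; congr [set _]; apply: val_inj.
by right; apply/MSO_lhd1.
Qed.

Lemma sat_succ n (s : nat -> MSO n) w x y (a b : 'I_n) : w != x -> w != y ->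
  s x = [set a] -> s y = [set b] -> sat s (is_succ w x y) <-> b = a.+1 :> nat.
Proof.
move=> wx wy sx sy.
rewrite satS /= /upd eqxx ![_ == w]eq_sym (negPf wx) (negPf wy) sx sy.
split=> [[/MSO_lhd1 ab h]|ba].
  apply/eqP; rewrite eqn_leq ab andbT leqNgt; apply/negP => ab'.
  have an : a.+1 < n by exact: ltn_trans (ltn_ord b).
  apply: h; exists [set Ordinal an]; split; first by exists (Ordinal an).
  by split; apply/MSO_lhd1.
split; first by apply/MSO_lhd1; rewrite ba.
case=> _ [[c ->] [/MSO_lhd1 ac /MSO_lhd1]]; rewrite ba ltnS => ca.
by have := leq_trans ac ca; rewrite ltnn.
Qed.

Definition cyclic_coloring n d h (A : nat -> {set 'I_n}) : Prop :=
  [/\ forall i, 0 < i <= d -> A i <> set0,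
      forall a, exists2 i, 0 < i <= d & a \in A i,
      forall i j a, 0 < i < j -> j <= d -> a \in A i -> a \in A j -> False &
  [/\ exists2 a : 'I_n, a = 0 :> nat & a \in A 1,
      forall (a b : 'I_n) i, b = a.+1 :> nat -> 0 < i <= d ->
        a \in A i -> b \in A (cnext d i) &
      exists2 a : 'I_n, a.+1 = n & a \in A h]].

Lemma MSO_exat n (s : nat -> MSO n) x p :
  sat s (FExAt x p) <-> exists a : 'I_n, sat (upd s x ([set a] : MSO n)) p.
Proof.
split=> [[X []]|[a h]]; first by rewrite /= upd_eq => -[a ->] h; exists a.
by exists [set a]; split=> //; exists a; rewrite /= upd_eq.
Qed.

Lemma MSO_allat n (s : nat -> MSO n) x p :
  sat s (FAllAt x p) <-> forall a : 'I_n, sat (upd s x ([set a] : MSO n)) p.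
Proof.
rewrite /FAllAt sat_all; split=> h a.
  by move: (h [set a]); rewrite sat_imp; apply; exists a; rewrite /= upd_eq.
by rewrite sat_imp [sat _ (FAt _)]/= upd_eq => -[b ->].
Qed.

Lemma sat_rho n (s : nat -> MSO n) d h : 0 < h <= d ->
  sat s (rho d h) <-> exists A : nat -> {set 'I_n}, cyclic_coloring d h A.
Proof.
move=> /andP[h0 hd].
have d0 : 0 < d by exact: leq_trans hd.
have I1 i : (i \in iota 1 d) = (0 < i <= d) by rewrite mem_iota add1n ltnS.
have nxt i : 0 < i <= d -> 0 < cnext d i <= d.
  by rewrite /cnext; case: ifP => [id _|_ _] //=.
have sub0 (r : nat -> MSO n) a i : 0 < i ->
    sat (upd r 0 ([set a] : MSO n)) (FSub 0 i) <-> a \in (r i : {set 'I_n}).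
  by case: i => // i _; rewrite /= upd_eq sub1set.
have subd (r : nat -> MSO n) a b i : 0 < i <= d ->
    sat (upd (upd r 0 ([set a] : MSO n)) d.+1 ([set b] : MSO n)) (FSub d.+1 i) <->
    b \in (r i : {set 'I_n}).
  case: i => // i /andP[_ id]; rewrite /= upd_eq sub1set /upd.
  by rewrite ltn_eqF // ltnS.
have lst r a : sat (upd r 0 ([set a] : MSO n)) (is_least d.+1 0) <-> a = 0 :> nat.
  exact: sat_least.
have grt r a : sat (upd r 0 ([set a] : MSO n)) (is_greatest d.+1 0) <-> a.+1 = n.
  exact: sat_greatest.
have suc r a b : sat (upd (upd r 0 ([set a] : MSO n)) d.+1 ([set b] : MSO n))
    (is_succ d.+2 0 d.+1) <-> b = a.+1 :> nat.
  by apply: sat_succ => //; rewrite ?upd_eq // gtn_eqF.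
rewrite /rho sat_exseq; split.
  case=> r _; rewrite !sat_and sat_bigand_map sat_bigand_pairs !MSO_allat !MSO_exat.
  case=> c1 [c2 [c3 [[a0]]]]; rewrite sat_and lst => -[a00].
  rewrite sub0 // => c4 [c5 [an]]; rewrite sat_and grt => -[ann].
  rewrite sub0 // => c6.
  exists r; split.
  - by move=> i hi; apply: c1; rewrite I1.
  - move=> a; move: (c2 a); rewrite sat_bigor_map => -[i].
    by rewrite I1 => hi; rewrite sub0; [exists i|case/andP: hi].
  - move=> i j a /andP[i0 ij] jd ai aj; have j0 := ltn_trans i0 ij.
    have := c3 j _ i; rewrite I1 mem_iota jd j0 i0 add1n prednK //.
    move=> /(_ isT ij); rewrite MSO_allat => /(_ a); apply.
    by split; apply/sub0.
  split; [by exists a0| |by exists an].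
  move=> a b i ba hi ai.
  move: (c5 a); rewrite sat_imp sat_bigand_map => H.
  have {H}/H/(_ i) : sat (upd r 0 ([set a] : MSO n)) (FNot (is_greatest d.+1 0)).
    by move=> /grt an'; have := ltn_ord b; rewrite ba an' ltnn.
  rewrite I1 sat_imp sub0 ?MSO_exat; last by case/andP: hi.
  move=> /(_ hi ai)[c]; rewrite sat_and suc subd ?nxt // => -[cE].
  by have -> : c = b by apply: val_inj; rewrite /= ba cE.
case=> A [c1 c2 c3 [[a0 a00 c4] c5 [an ann c6]]].
pose r i : MSO n := if 0 < i <= d then A i else s i.
have rE i : 0 < i <= d -> r i = A i by rewrite /r => ->.
exists r; first by move=> i; rewrite I1 /r => /negPf->.
rewrite !sat_and sat_bigand_map sat_bigand_pairs !MSO_allat !MSO_exat; split.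
  by move=> i; rewrite I1 => hi; rewrite /= rE //; exact: c1.
split.
  move=> a; apply/sat_bigor_map; have [i hi ai] := c2 a; exists i; first by rewrite I1.
  by rewrite sub0 ?rE //; case/andP: hi.
split.
  move=> j; rewrite I1 => /andP[j0 jd] i.
  rewrite mem_iota add1n prednK // => /andP[i0 ij]; apply/MSO_allat => a.
  have id : i <= d by rewrite (leq_trans _ jd) // ltnW.
  move=> [/(sub0 _ _ _ i0) + /(sub0 _ _ _ j0)]; rewrite !rE ?i0 ?j0 // => ai aj.
  by apply: (c3 i j a) => //; rewrite i0.
split; first by exists a0; rewrite sat_and lst sub0 // rE ?d0.
split; last by exists an; rewrite sat_and grt sub0 // rE ?h0.
move=> a; rewrite sat_imp sat_bigand_map => ng i; rewrite I1 => hi.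
rewrite sat_imp sub0 ?rE ?MSO_exat //; last by case/andP: hi.
move=> ai; have lan : a.+1 < n.
  by rewrite ltn_neqAle ltn_ord andbT; apply/eqP => e; apply/ng/grt.
exists (Ordinal lan); rewrite sat_and suc subd ?nxt // rE ?nxt //.
by split=> //; exact: (c5 a).
Qed.

Lemma cnext_mod d k : 0 < d -> cnext d (k %% d).+1 = (k.+1 %% d).+1.
Proof.
move=> d0; rewrite /cnext -[k.+1]addn1 -modnDml addn1.
case: ltnP => h; first by rewrite (modn_small h).
have -> : (k %% d).+1 = d by have := ltn_pmod k d0; lia.
by rewrite modnn.
Qed.

Lemma cyclic_coloringP n d h : 0 < h <= d ->
  ((exists A : nat -> {set 'I_n}, cyclic_coloring d h A) -> n = h %[mod d]) /\
  (d <= n -> n = h %[mod d] -> exists A : nat -> {set 'I_n}, cyclic_coloring d h A).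
Proof.
move=> /andP[h0 hd]; have d0 : 0 < d by exact: leq_trans hd.
have rng k : 0 < (k %% d).+1 <= d by rewrite /= ltn_pmod.
split=> [[A [_ _ disj [[z z0 zA] nxt [t tn tA]]]]|dn nh].
  have H k (a : 'I_n) : a = k :> nat -> a \in A (k %% d).+1.
    elim: k a => [|k IH] a ak.
      by rewrite mod0n; have <- : z = a by apply: val_inj; rewrite /= z0 ak.
    rewrite -cnext_mod //.
    have kn : k < n by rewrite ltnW // -ak.
    exact: (nxt (Ordinal kn)) (rng k) (IH _ _).
  have tH := H t t erefl.
  have e : (t %% d).+1 = h.
    have [lt|lt|//] := ltngtP (t %% d).+1 h.
      by case: (disj _ _ t _ hd tH tA); rewrite lt.
    by case: (disj _ _ t _ _ tA tH); rewrite ?h0 // ltn_pmod.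
  by rewrite -tn -e -[(t %% d).+1]addn1 modnDml addn1.
exists (fun i => [set a : 'I_n | (a %% d).+1 == i]); split.
- move=> i /andP[i0 id].
  have iN : i.-1 < n by rewrite prednK // (leq_trans id).
  move=> /setP/(_ (Ordinal iN)); rewrite !inE /= modn_small ?prednK ?eqxx //.
- by move=> a; exists (a %% d).+1; rewrite ?inE.
- move=> i j a /andP[_ ij] _; rewrite !inE => /eqP-> /eqP e.
  by rewrite e ltnn in ij.
split.
- have n0 : 0 < n by exact: leq_trans dn.
  by exists (Ordinal n0); rewrite ?inE //= mod0n.
- by move=> a b i ba _; rewrite !inE => /eqP<-; rewrite cnext_mod // ba.
- have n1 : n.-1 < n by rewrite prednK // (leq_trans d0).
  have n0 := leq_trans d0 dn.
  exists (Ordinal n1); rewrite ?inE /= ?prednK //.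
  apply/eqP; have e : (n.-1 %% d).+1 = h %[mod d].
    by rewrite -addn1 modnDml addn1 prednK.
  have := ltn_pmod n.-1 d0; rewrite -ltnS => l.
  have [E|E] := eqVneq h d.
    move: e; rewrite E modnn; have [->//|ne] := eqVneq (n.-1 %% d).+1 d.
    by rewrite modn_small // ltn_neqAle ne -ltnS.
  move: e; rewrite (@modn_small h) ?ltn_neqAle ?E //.
  have [->|ne] := eqVneq (n.-1 %% d).+1 d; first by rewrite modnn => e; rewrite -e in h0.
  by rewrite modn_small // ltn_neqAle ne -ltnS.
Qed.

Lemma rho_index d r : 0 < d ->
  let h := (absz (modz (Posz r - 1)%R (Posz d))).+1 in
  0 < h <= d /\ h = r %[mod d].
Proof.
move=> d0 h; rewrite {}/h; case: r => [|r].
  have -> : (Posz 0 - 1)%R = Negz 0 by [].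
  rewrite modNz_nat // mod0n.
  have -> : (Posz d - 1 - 0%Z)%R = Posz d.-1 by lia.
  by rewrite /= prednK // leqnn modnn.
have -> : (Posz r.+1 - 1)%R = Posz r by lia.
by rewrite modz_nat /= ltn_pmod // -addn1 modnDml addn1.
Qed.

Lemma MSO_rho n d r : 0 < d ->
  (holds (MSO n) (rho_int d (Posz r)) -> n = r %[mod d]) /\
  (d <= n -> n = r %[mod d] -> holds (MSO n) (rho_int d (Posz r))).
Proof.
move=> d0; have [hd hr] := rho_index r d0; rewrite -hr.
have [H1 H2] := cyclic_coloringP n hd.
split=> [/(_ (fun _ => bot_ _))/(sat_rho _ hd)/H1//|dn e s].
by apply/(sat_rho _ hd); exact: H2.
Qed.

(** * Ultraproducts *)

Record ultrafilter (I : Type) (U : (I -> Prop) -> Prop) : Prop := {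
  ultraS : forall P Q : I -> Prop, (forall i, P i -> Q i) -> U P -> U Q;
  ultraI : forall P Q : I -> Prop, U P -> U Q -> U (fun i => P i /\ Q i);
  ultraN : forall P : I -> Prop, U (fun i => ~ P i) <-> ~ U P }.

Lemma nonprincipal_ultrafilter :
  exists2 U : (nat -> Prop) -> Prop, ultrafilter U &
    forall N, U (fun i => N <= i).
Proof.
have [U [UU sU]] := filter.ultraFilterLemma filter.eventually_filter.
have UF := filter.ultra_proper (UltraFilter := UU).
have FF := filter.filter_filter (ProperFilter := UF).
exists U; last by move=> N; apply: sU; exists N.
split.
- by move=> P Q PQ; apply: filter.filterS.
- by move=> P Q; apply: filter.filterI.
- move=> P; split=> [nP uP|nP].
    apply: (filter.filter_not_empty U); apply: filter.filterS (filter.filterI nP uP).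
    by move=> i [].
  by have [//|] := filter.in_ultra_setVsetC P UU.
Qed.

Section Ultraproduct.
Context (I : Type) (Ms : I -> structure) (U : (I -> Prop) -> Prop).
Context (UU : ultrafilter U).

Let choices := forall i, Ms i.

Definition ultra_eq (f : choices) : choices -> Prop :=
  fun g => U (fun i => f i = g i).

(** Elements are equivalence classes of families modulo [U], represented as
    predicates because [sat] interprets equality by Leibniz equality. *)
Definition ultra_dom := {P : choices -> Prop | exists f, P = ultra_eq f}.

Definition ultra_class (f : choices) : ultra_dom :=
  exist _ (ultra_eq f) (ex_intro _ f erefl).

Definition ultra_repr (X : ultra_dom) : choices := projT1 (cid (svalP X)).

Definition ultraproduct : structure :=
  {| dom := ultra_dom;
     sub_ := fun X Y => U (fun i => sub_ (ultra_repr X i) (ultra_repr Y i));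
     bot_ := ultra_class (fun i => bot_ (Ms i));
     at_ := fun X => U (fun i => at_ (ultra_repr X i));
     lhd_ := fun X Y => U (fun i => lhd_ (ultra_repr X i) (ultra_repr Y i)) |}.

Lemma ultraT (P : I -> Prop) : (forall i, P i) -> U P.
Proof.
move=> hP; apply: contrapT => /(ultraN UU) nP.
have nn : ~ U (fun i => ~ ~ P i) by move=> /(ultraN UU).
by apply: nn; apply: (ultraS UU) nP => i; case.
Qed.

Lemma ultra_class_inj f g : ultra_class f = ultra_class g -> U (fun i => f i = g i).
Proof.
move=> /(congr1 sval) /= e.
have : ultra_eq g g by exact: ultraT.
by rewrite -e.
Qed.

Lemma ultra_eq_class f g : U (fun i => f i = g i) -> ultra_class f = ultra_class g.
Proof.
move=> fg; suff e : ultra_eq f = ultra_eq g.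
  by apply: eq_exist.
apply/funext => k; apply/propext; rewrite /ultra_eq; split=> h.
  by apply: (ultraS UU) (ultraI UU fg h) => i [->].
by apply: (ultraS UU) (ultraI UU fg h) => i [->].
Qed.

Lemma ultra_reprK X : ultra_class (ultra_repr X) = X.
Proof.
rewrite /ultra_repr; case: X => P hP /=; case: cid => f /= e.
exact: eq_exist.
Qed.

Lemma ultra_classK f : U (fun i => ultra_repr (ultra_class f) i = f i).
Proof. exact/ultra_class_inj/ultra_reprK. Qed.

Lemma ultra_eval (s : nat -> ultraproduct) t :
  U (fun i => ultra_repr (eval s t) i = eval (fun x => ultra_repr (s x) i) t).
Proof. by case: t => [x|] /=; [exact: ultraT|exact: ultra_classK]. Qed.

Lemma Los (s : nat -> ultraproduct) p :
  sat s p <-> U (fun i => sat (fun x => ultra_repr (s x) i) p).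
Proof.
pose r s i x : Ms i := ultra_repr (s x) i.
elim: p s => [t u|t u|t|t u|p IH|p IHp q IHq|x p IH] s.
- have et := ultra_eval s t; have eu := ultra_eval s u; split=> /= [e|h].
    by apply: (ultraS UU) (ultraI UU et eu) => i [<- <-]; rewrite e.
  rewrite -(ultra_reprK (eval s t)) -(ultra_reprK (eval s u)).
  apply: ultra_eq_class.
  by apply: (ultraS UU) (ultraI UU h (ultraI UU et eu)) => i [h' [-> ->]].
- have et := ultra_eval s t; have eu := ultra_eval s u; split=> /= h.
    by apply: (ultraS UU) (ultraI UU h (ultraI UU et eu)) => i [h' [<- <-]].
  by apply: (ultraS UU) (ultraI UU h (ultraI UU et eu)) => i [h' [-> ->]].
- have et := ultra_eval s t; split=> /= h.
    by apply: (ultraS UU) (ultraI UU h et) => i [h' <-].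
  by apply: (ultraS UU) (ultraI UU h et) => i [h' ->].
- have et := ultra_eval s t; have eu := ultra_eval s u; split=> /= h.
    by apply: (ultraS UU) (ultraI UU h (ultraI UU et eu)) => i [h' [<- <-]].
  by apply: (ultraS UU) (ultraI UU h (ultraI UU et eu)) => i [h' [-> ->]].
- by rewrite (ultraN UU) -IH.
- rewrite sat_and IHp IHq; split=> [[hp hq]|h].
    exact: (ultraI UU hp hq).
  by split; apply: (ultraS UU) h => i [].
- have updr X i : (fun y => ultra_repr (upd s x X y) i) =
      upd (fun y => ultra_repr (s y) i) x (ultra_repr X i).
    by apply/funext => y; rewrite /upd; case: eqP.
  split=> [[X /IH h]|h].
    by apply: (ultraS UU) h => i; rewrite updr; exists (ultra_repr X i).
  have ex i : exists a : Ms i,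
      sat (fun y => ultra_repr (s y) i) (FEx x p) ->
      sat (upd (fun y => ultra_repr (s y) i) x a) p.
    have [[a ha]|nh] := pselect (sat (fun y => ultra_repr (s y) i) (FEx x p)).
      by exists a.
    by exists (bot_ (Ms i)) => /nh.
  pose f i := projT1 (cid (ex i)); pose hf i := projT2 (cid (ex i)).
  exists (ultra_class f); apply/IH.
  apply: (ultraS UU) (ultraI UU h (ultra_classK f)) => i [/hf hi e].
  by rewrite updr e.
Qed.

End Ultraproduct.

Lemma Los_holds (I : Type) (Ms : I -> structure) U (UU : ultrafilter U) p :
  U (fun i => holds (Ms i) p) -> holds (ultraproduct Ms U) p.
Proof. by move=> h s; apply/(Los UU); apply: (ultraS UU) h => i; apply. Qed.

(** * Residues *)

Lemma eqmod_prime_powers d m n : 0 < d ->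
  (forall p j, prime p -> 0 < j -> p ^ j %| d -> m = n %[mod p ^ j]) ->
  m = n %[mod d].
Proof.
move=> d0; wlog nm : m n / n <= m.
  move=> H h; case/orP: (leq_total n m) => l; first exact: H.
  by symmetry; apply: H => // p j pp j0 pd; rewrite h.
move=> h; apply/eqP; rewrite eqn_mod_dvd //; apply/dvdn_partP => // p pd.
have pp : prime p by move: pd; rewrite mem_primes => /andP[].
rewrite p_part -eqn_mod_dvd //; apply/eqP/h => //.
  by rewrite logn_gt0.
exact: pfactor_dvdnn.
Qed.

Lemma residue_dvd rt d e : residue_function rt -> 1 < d -> 1 < e -> d %| e ->
  rt e = rt d %[mod d].
Proof.
case=> r _ hr d1 e1 de; apply: eqmod_prime_powers; first exact: ltnW.
move=> p j pp j0 pd; have [_ ->//] := hr d d1.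
by have [_ ->//] := hr e e1; exact: dvdn_trans de.
Qed.

Lemma residue_consistent rt : residue_function rt -> consistent_theory (T_res rt).
Proof.
move=> hrt; have [U UU Unat] := nonprincipal_ultrafilter.
pose N i := rt i`! + i`!.
have iN i : i <= N i by exact: leq_trans (fact_geq i) (leq_addl _ _).
exists (ultraproduct (fun i => MSO (N i)) U) => p [hp|[n ->]|[d d1 ->]];
  apply: (Los_holds UU).
- by apply: (ultraT UU) => i; exact: MSO_Fin.
- apply: (ultraS UU) (Unat n.+1) => i ni; apply/MSO_psi.
  exact: leq_trans (iN i).
- apply: (ultraS UU) (Unat d) => i di.
  have d0 : 0 < d by exact: ltnW.
  have [_] := MSO_rho (N i) (rt d) d0; apply; first exact: leq_trans (iN i).
  have dfi : d %| i`! by apply: dvdn_fact; rewrite d0.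
  rewrite /N -modnDmr (eqP dfi) addn0 residue_dvd //.
  by rewrite (leq_trans d1) // (leq_trans di) // fact_geq.
Qed.

Lemma residue_complete rt : residue_function rt -> complete_theory (T_res rt).
Proof.
move=> hrt p hp; have [c [d [d1 per]]] := MSO_periodic p.
have d0 := ltnW d1.
have key M : model M (T_res rt) ->
    (holds M p <-> holds (MSO (rt d + c * d)) p).
  move=> HM; have HF : model M T_MSOFin by move=> q hq; apply: HM; apply: Or31.
  have [n hn] := pseudofinite HF [:: p; psi_gt c; rho_int d (Posz (rt d))].
  have /MSO_psi cn : holds (MSO n) (psi_gt c).
    by apply/hn; [right; left|apply: HM; apply: Or32; exists c].
  have /(MSO_rho _ _ d0).1 nd : holds (MSO n) (rho_int d (Posz (rt d))).
    by apply/hn; [right; right; left|apply: HM; apply: Or33; exists d].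
  rewrite hn; last by left.
  apply: per; first exact: ltnW.
    by rewrite (leq_trans _ (leq_addl _ _)) // leq_pmulr.
  by rewrite nd -modnDmr modnMl addn0.
have [h|h] := pselect (holds (MSO (rt d + c * d)) p); [left|right] => M HM.
  exact/key.
move=> s sp; apply: h; apply/(key M) => // s'.
by apply/(eq_sat (s := s)) => // x; rewrite (eqP (introT eqP hp)).
Qed.

Lemma complete_consequence T M : complete_theory T -> model M T ->
  forall p, sentence p -> (consequence T p <-> holds M p).
Proof.
move=> cT HM p sp; split=> [|h]; first by apply.
have [//|np] := cT p sp.
by case: (np M HM (fun _ => bot_ M)); exact: h.
Qed.

Lemma complete_infinite T M : complete_theory T -> model M T ->
  model M T_MSOFin -> (forall n, ~ same_consequences T (Th (MSO n))) ->
  forall m, holds M (psi_gt m).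
Proof.
move=> cT HM HF nT m; apply: contrapT => nm.
have ex : exists k, `[< ~ holds M (psi_gt k) >] by exists m; apply/asboolP.
have [k /asboolP nk kmin] := ex_minnP ex.
apply: (nT k) => p sp; rewrite (complete_consequence cT HM sp).
have [n hn] := pseudofinite HF [:: p; psi_gt k; psi_gt k.-1].
have nE : n = k.
  apply/eqP; rewrite eqn_leq; apply/andP; split.
    by rewrite leqNgt; apply/negP => /MSO_psi/hn h; apply: nk; apply: h; right; left.
  case: k nk kmin hn => // k _ kmin hn; apply/MSO_psi/hn; first by right; right; left.
  apply: contrapT => /asboolP/kmin; by rewrite ltnn.
rewrite hn ?nE; last by left.
split=> [h M' HM'|h]; first by apply: HM'; split.
by apply: h => q [].
Qed.

Lemma model_residue M : model M T_MSOFin -> (forall m, holds M (psi_gt m)) ->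
  exists2 rt, residue_function rt & model M (T_res rt).
Proof.
move=> HF inf.
have /choice[rt hrt] d : exists h, 1 < d -> h < d /\ holds M (rho_int d (Posz h)).
  have [d1|] := ltnP 1 d; last by exists 0.
  have [n hn] := pseudofinite HF
    (psi_gt d :: [seq rho_int d (Posz h) | h <- iota 0 d]).
  have /MSO_psi dn : holds (MSO n) (psi_gt d) by apply/hn; [left|exact: inf].
  exists (n %% d) => _; have l : n %% d < d by rewrite ltn_pmod // ltnW.
  split=> //; apply/hn.
    by right; apply/in_mapP; exists (n %% d) => //; rewrite mem_iota.
  by apply/(MSO_rho n _ (ltnW d1)).2; [exact: ltnW|rewrite modn_mod].
have compat d e : 1 < d -> 1 < e -> d %| e -> rt e = rt d %[mod d].
  move=> d1 e1 de; have [_ hd] := hrt d d1; have [_ he] := hrt e e1.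
  have [n hn] := pseudofinite HF [:: rho_int d (Posz (rt d)); rho_int e (Posz (rt e))].
  have nd : n = rt d %[mod d].
    by apply: (MSO_rho n (rt d) (ltnW d1)).1; apply/hn => //; left.
  have ne : n = rt e %[mod e].
    by apply: (MSO_rho n (rt e) (ltnW e1)).1; apply/hn => //; right; left.
  by rewrite -nd -(modn_dvdm n de) ne modn_dvdm.
have pw p j : prime p -> 0 < j -> 1 < p ^ j.
  by move=> pp j0; rewrite -(exp1n j) ltn_exp2r // prime_gt1.
exists rt; last first.
  move=> p [hp|[m ->]|[d d1 ->]]; [exact: HF|exact: inf|].
  by have [] := hrt d d1.
exists (fun p j => rt (p ^ j)) => [p j pp j0|d d1].
  split; first by have [] := hrt _ (pw p j pp j0).
  by apply: compat; rewrite ?pw // dvdn_exp2l.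
split=> [|p j pp j0 pd]; first by have [] := hrt d d1.
by apply: compat; rewrite ?pw.
Qed.

Theorem theorem4p18 :
  (forall rt : nat -> nat, residue_function rt ->
     [/\ complete_theory (T_res rt), consistent_theory (T_res rt) & extends (T_res rt) T_MSOFin])
  /\
  (forall T : theory, is_theory T ->
     complete_theory T -> consistent_theory T -> extends T T_MSOFin ->
     (forall n : nat, ~ same_consequences T (Th (MSO n))) ->
     exists2 rt : nat -> nat, residue_function rt & same_consequences T (T_res rt)).
Proof.
split=> [rt hrt|T _ cT [M HM] eT nT].
  split; [exact: residue_complete|exact: residue_consistent|].
  by move=> p hp M HM; apply: HM; apply: Or31.
have HF : model M T_MSOFin by move=> p /eT; apply.
have [rt hrt HR] := model_residue HF (complete_infinite cT HM HF nT).
exists rt => // p sp.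
by rewrite (complete_consequence cT HM sp)
  (complete_consequence (residue_complete hrt) HR sp).
Qed.
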